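(* For every $A\in 2^\omega$, no higher $A$-c.e. set $X\subseteq\omega$ (identified with its characteristic sequence in $2^\omega$) is higher $A$-Kurtz random.
   Context: For $A\in 2^\omega$ and a countable set $D$ ($D=\omega$ or $D=2^{<\omega}$), and $W\subseteq 2^{<\omega}\times D$, let $W^A=\{d\in D : (\exists \tau\prec A)\ (\tau,d)\in W\}$, where $\tau\prec A$ means that $\tau$ is a finite initial segment of $A$. A subset of $D$ is higher $A$-c.e. if it equals $W^A$ for some $\Pi^1_1$ (lightface, no oracle) set $W\subseteq 2^{<\omega}\times D$. For $V\subseteq 2^{<\omega}$ let $[V]^\prec=\{X\in 2^\omega : (\exists\sigma\prec X)\ \sigma\in V\}$. A subset of $2^\omega$ is higher $A$-c.e. open if it is $[V]^\prec$ for some higher $A$-c.e. set $V\subseteq 2^{<\omega}$; it is higher $A$-effectively closed if its complement is higher $A$-c.e. open. A sequence in $2^\omega$ is higher $A$-Kurtz random if it is an element of no higher $A$-effectively closed set of measure zero (with respect to the fair-coin measure on $2^\omega$). *)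

(* Defs.v *)
From HB Require Import structures.
From mathcomp Require Import all_boot all_order all_algebra.
From mathcomp Require Import all_classical all_reals all_analysis measurable_realfun.
From mathcomp Require Import lra.
Set Implicit Arguments.
Unset Strict Implicit.
Unset Printing Implicit Defensive.
Import Order.TTheory GRing.Theory Num.Theory.

Local Open Scope classical_set_scope.
Local Open Scope nat_scope.

(* [Pi^1_1] is defined as in second-order arithmetic: a [Pi^1_1] formula is
   [forall X, phi] with [phi] arithmetical, i.e. with number quantifiers only,
   in the language 0, 1, +, *, =, <, membership in X.  Number variables are
   indexed by [nat]. *)
Inductive aterm : Type :=
| AVar of nat
| AZero
| AOne
| AAdd of aterm & aterm
| AMul of aterm & aterm.

Inductive aform : Type :=
| AEq of aterm & aterm
| ALt of aterm & aterm
| AMem of aterm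
| ANot of aform
| AAnd of aform & aform
| AOr of aform & aform
| AEx of nat & aform
| AAll of nat & aform.

Fixpoint aeval (e : nat -> nat) (t : aterm) : nat :=
  match t with
  | AVar i => e i
  | AZero => 0
  | AOne => 1
  | AAdd t u => aeval e t + aeval e u
  | AMul t u => aeval e t * aeval e u
  end.

Fixpoint aholds (X : set nat) (e : nat -> nat) (phi : aform) : Prop :=
  match phi with
  | AEq t u => aeval e t = aeval e u
  | ALt t u => aeval e t < aeval e u
  | AMem t => X (aeval e t)
  | ANot p => ~ aholds X e p
  | AAnd p q => aholds X e p /\ aholds X e q
  | AOr p q => aholds X e p \/ aholds X e q
  | AEx i p => exists a : nat, aholds X [eta e with i |-> a] p
  | AAll i p => forall a : nat, aholds X [eta e with i |-> a] p
  end.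

(* The number whose binary expansion, least significant bit first, is [s]
   followed by 1; this is a bijection from strings to positive integers. *)
Definition strcode (s : seq bool) : nat :=
  foldr (fun (b : bool) m => b + m.*2) 1 s.

Lemma strcode_gt0 s : 0 < strcode s.
Proof. by elim: s => //= b s IH; rewrite addn_gt0 double_gt0 IH orbT. Qed.

Lemma strcode_inj : injective strcode.
Proof.
elim=> [|b s IH] [|c t] //=.
- by have := strcode_gt0 t; case: c; case: (strcode t).
- by have := strcode_gt0 s; case: b; case: (strcode s).
- move=> e; have eb : b = c.
    by have := congr1 odd e; rewrite !oddD !odd_double !addbF !oddb.
  by subst c; move/addnI/double_inj/IH: e => ->.
Qed.

(* Lightface [Pi^1_1] sets of pairs.  Elements of [D] enter formulas through
   [codeD]: the identity for [D = nat], [strcode] for [D = seq bool].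
   Variables 0 and 1 hold the (codes of the) two components, every other free
   variable is 0, so that no parameters are allowed. *)
Definition Pi11 (D : Type) (codeD : D -> nat) (W : set (seq bool * D)) : Prop :=
  exists phi : aform, forall (tau : seq bool) (d : D),
    W (tau, d) <->
    forall X : set nat, aholds X (nth 0 [:: strcode tau; codeD d]) phi.

Definition initseg (tau : seq bool) (A : nat -> bool) : Prop :=
  tau = mkseq A (size tau).

Definition oracle_section (D : Type) (W : set (seq bool * D)) (A : nat -> bool)
    : set D :=
  [set d | exists2 tau, initseg tau A & W (tau, d)].

Definition higher_ce (D : Type) (codeD : D -> nat) (A : nat -> bool)
    (S : set D) : Prop :=
  exists2 W : set (seq bool * D), Pi11 codeD W & S = oracle_section W A.

Definition open_of (V : set (seq bool)) : set (nat -> bool) :=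
  [set X | exists2 sigma, initseg sigma X & V sigma].

Definition higher_ce_open (A : nat -> bool) (U : set (nat -> bool)) : Prop :=
  exists2 V : set (seq bool), higher_ce strcode A V & U = open_of V.

Definition higher_eff_closed (A : nat -> bool) (C : set (nat -> bool)) : Prop :=
  higher_ce_open A (~` C).

Definition cylinder (s : seq bool) : set (nat -> bool) := [set X | initseg s X].

(* Cantor space with its Borel sigma-algebra. *)
Notation cantorM := (g_sigma_algebraType (range cylinder)).

Lemma measurable_cylinder s : measurable (cylinder s : set cantorM).
Proof. by apply: sub_sigma_algebra; exists s. Qed.

Lemma measurable_open_of V : measurable (open_of V : set cantorM).
Proof.
have -> : open_of V = \bigcup_(s in V) cylinder s.
  by apply/seteqP; split=> X [s]; exists s.
rewrite bigcup_mkcond; apply: countable_bigcupT_measurable => // s.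
by case: ifP => _; [exact: measurable_cylinder|exact: measurable0].
Qed.

Section fair_coin.
Context {R : realType}.
Local Open Scope ring_scope.

Definition doubling (x : R) : R := if 2^-1 <= x then 2 * x - 1 else 2 * x.

(* On [0, 1) these are the binary digits of [x], never ending in all ones. *)
Definition bindigits (x : R) : nat -> bool := fun n => 2^-1 <= iter n doubling x.


Lemma measurable_doubling : measurable_fun [set: R] doubling.
Proof.
apply: measurable_fun_ifT.
- by apply: measurable_fun_ler; [exact: measurable_cst|exact: measurable_id].
- by apply: measurable_funB => //; exact: measurable_funM.
- exact: measurable_funM.
Qed.

Lemma measurable_bindigit n : measurable_fun [set: R] (bindigits ^~ n).
Proof.
rewrite /bindigits; apply: measurable_fun_ler; first exact: measurable_cst.
elim: n => [|n IH]; first exact: measurable_id.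
exact: (measurableT_comp measurable_doubling IH).
Qed.

Lemma initseg_cons b s X :
  initseg (b :: s) X <-> X 0%N = b /\ initseg s (fun n => X n.+1).
Proof.
rewrite /initseg /mkseq /= (iotaDl 1 0) -map_comp.
by split=> [[-> e]|[-> e]]; [split|congr cons].
Qed.

Lemma measurable_bindigits :
  measurable_fun [set: R] (bindigits : R -> cantorM).
Proof.
apply: (@measurability _ _ _ cantorM _ _ (range cylinder)) => //.
move=> _ [_ [s _ <-] <-]; rewrite setTI.
have -> : bindigits @^-1` cylinder s =
    \bigcap_(n in `I_(size s)) ((bindigits ^~ n) @^-1` [set nth false s n]).
  apply/seteqP; split=> [x /= sx n /= ns|x /= sx].
    by rewrite [in RHS]sx nth_mkseq.
  rewrite /cylinder /= /initseg; apply: (@eq_from_nth _ false).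
    by rewrite size_mkseq.
  by move=> n ns; rewrite nth_mkseq// sx.
apply: bigcap_measurableType => // n _; rewrite -[X in measurable X]setTI.
exact: measurable_bindigit.
Qed.

(* The fair-coin measure on Cantor space: the law of the binary digits of a
   uniformly distributed point of [0, 1). *)
Definition fair_coin : set cantorM -> \bar R :=
  pushforward (mrestr lebesgue_measure (measurable_itv `[0, 1[%R))
    (bindigits : R -> cantorM).


Let fair_coin_measure : {measure set cantorM -> \bar R} :=
  @measure_function_pushforward__canonical__measure_function_Measure
    _ _ _ _ _ (mrestr lebesgue_measure (measurable_itv `[0, 1[%R))
    _ measurable_bindigits.

Let fair_coin0 : fair_coin set0 = 0%E.
Proof. exact: (measure0 fair_coin_measure). Qed.

Let fair_coin_ge0 U : (0 <= fair_coin U)%E.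
Proof. exact: (measure_ge0 fair_coin_measure). Qed.

Let fair_coin_sigma_additive : semi_sigma_additive fair_coin.
Proof. exact: (@measure_semi_sigma_additive _ _ _ fair_coin_measure). Qed.

HB.instance Definition _ := isMeasure.Build _ _ _ fair_coin
  fair_coin0 fair_coin_ge0 fair_coin_sigma_additive.

Let fair_coin_setT : fair_coin [set: _] = 1%E.
Proof.
rewrite /fair_coin /pushforward preimage_setT /mrestr setTI.
by rewrite lebesgue_measure_itv /= lte_fin ltr01 sube0.
Qed.

HB.instance Definition _ := Measure_isProbability.Build _ _ _ fair_coin
  fair_coin_setT.

Definition dyadic (s : seq bool) : R :=
  foldr (fun (b : bool) y => ((b : nat)%:R + y) / 2) 0 s.

Lemma dyadic_ge0 s : 0 <= dyadic s.
Proof. by elim: s => //= b s IH; rewrite divr_ge0 ?addr_ge0. Qed.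

Lemma dyadic_le1 s : dyadic s + 2^-1 ^+ size s <= 1.
Proof.
elim: s => [|b s IH] /=; first by rewrite expr0 add0r.
by rewrite exprS; case: b => /=; lra.
Qed.

Lemma bindigitsS (x : R) n : bindigits x n.+1 = bindigits (doubling x) n.
Proof. by rewrite /bindigits iterSr. Qed.

Lemma bindigits_itv s (x : R) : 0 <= x < 1 ->
  initseg s (bindigits x) <-> dyadic s <= x < dyadic s + 2^-1 ^+ size s.
Proof.
elim: s x => [|b s IH] x x01; first by rewrite /= expr0 add0r x01.
have /andP[x0 x1] := x01.
have d01 : 0 <= doubling x < 1.
  by rewrite /doubling; case: (leP 2^-1 x) => ?; apply/andP; split; lra.
have -> : initseg (b :: s) (bindigits x) <->
    (2^-1 <= x) = b /\ initseg s (bindigits (doubling x)).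
  rewrite initseg_cons; suff -> : (fun n => bindigits x n.+1) =
    bindigits (doubling x) by [].
  by apply/funext => n; exact: bindigitsS.
rewrite (IH _ d01) /= exprS /doubling.
have := dyadic_ge0 s; have := dyadic_le1 s.
move: (dyadic s) (2^-1 ^+ size s) => u v uv u0.
case: (leP 2^-1 x) => hx; case: b => /=; split; rewrite ?mulr1n ?mulr0n.
- by case=> _ /andP[h1 h2]; apply/andP; split; lra.
- by move=> /andP[h1 h2]; split=> //; apply/andP; split; lra.
- by case.
- by move=> /andP[h1 h2]; exfalso; lra.
- by case.
- by move=> /andP[h1 h2]; exfalso; lra.
- by case=> _ /andP[h1 h2]; apply/andP; split; lra.
- by move=> /andP[h1 h2]; split=> //; apply/andP; split; lra.
Qed.

Lemma fair_coin_cylinder s : fair_coin (cylinder s) = (2^-1 ^+ size s)%:E.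
Proof.
rewrite /fair_coin /pushforward /mrestr.
have -> : bindigits @^-1` cylinder s `&` `[0, 1[ =
    [set` `[dyadic s, dyadic s + 2^-1 ^+ size s[] :> set R.
  apply/seteqP; split=> x /=; rewrite !in_itv /=.
    by case=> sx x01; apply/bindigits_itv.
  move=> sx; have x01 : 0 <= x < 1.
    have := dyadic_ge0 s; have := dyadic_le1 s.
    by case/andP: sx => *; apply/andP; split; lra.
  by split=> //; apply/bindigits_itv.
rewrite lebesgue_measure_itv /= lte_fin ltrDl exprn_gt0 ?invr_gt0//.
by rewrite -EFinD addrAC subrr add0r.
Qed.

End fair_coin.

Definition higher_kurtz_random (R : realType) (A Z : nat -> bool) : Prop :=
  forall C : set (nat -> bool), higher_eff_closed A C ->
    @fair_coin R C = 0%E -> ~ C Z.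

Definition char_seq (S : set nat) : nat -> bool := fun n => `[< S n >].

(* Main.v *)
(* A higher [A]-c.e. set [S] makes [{Y | Y is constantly b on S}] higher
   [A]-effectively closed, because its complement only needs positive
   information on [S]: a string [sigma] ending in [~~ b] is enumerated once
   [size sigma - 1] enters [S].  This class is null as soon as [S] is infinite.
   If [X] is infinite, take [S = X] and [b = true]; if [X] is finite, take for
   [S] a final segment of [nat] disjoint from [X], and [b = false]. *)
Require Import Defs.
From mathcomp Require Import all_boot all_order all_algebra.
From mathcomp Require Import all_classical all_reals all_analysis.
From mathcomp Require Import zify.
Set Implicit Arguments.
Unset Strict Implicit.
Unset Printing Implicit Defensive.
Import Order.TTheory GRing.Theory Num.Theory.

Local Open Scope classical_set_scope.
Local Open Scope nat_scope.

(** * Coding two sets in one set variable, and strings in arithmetical formulas *)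

Fixpoint adouble (phi : aform) : aform :=
  match phi with
  | AEq t u => AEq t u
  | ALt t u => ALt t u
  | AMem t => AMem (AAdd t t)
  | ANot p => ANot (adouble p)
  | AAnd p q => AAnd (adouble p) (adouble q)
  | AOr p q => AOr (adouble p) (adouble q)
  | AEx i p => AEx i (adouble p)
  | AAll i p => AAll i (adouble p)
  end.

Lemma aholds_adouble (X : set nat) (e : nat -> nat) (phi : aform) :
  aholds X e (adouble phi) <-> aholds [set n | X (n + n)] e phi.
Proof.
elim: phi e => //=.
- by move=> p IH e; split=> h /IH.
- by move=> p IHp q IHq e; rewrite IHp IHq.
- by move=> p IHp q IHq e; rewrite IHp IHq.
- by move=> i p IH e; split=> -[a] /IH; exists a.
- by move=> i p IH e; split=> h a; apply/IH.
Qed.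

(** A pairing given by a polynomial, so that it is a term of the language. It is injective because
    [(a + b)^2 + a] lies below [(a + b + 1)^2] and so determines [a + b]. Doubling and adding 1
    moves the values to the odd numbers, away from what [adouble] reads. *)
Definition oddpair (a b : nat) : nat :=
  ((a + b) * (a + b) + a) + ((a + b) * (a + b) + a) + 1.

Definition toddpair (t u : aterm) : aterm :=
  let q := AAdd (AMul (AAdd t u) (AAdd t u)) t in AAdd (AAdd q q) AOne.

Lemma oddpair_inj a b c d : oddpair a b = oddpair c d -> a = c /\ b = d.
Proof.
rewrite /oddpair => e.
have h : (a + b) * (a + b) + a = (c + d) * (c + d) + c by lia.
by case: (ltngtP (a + b) (c + d)) => l; nia.
Qed.

Lemma oddpair_odd a b n : oddpair a b <> n + n.
Proof. by rewrite /oddpair; lia. Qed.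

(* The bound variables 2 and 3 are reset to 0 before [phi], which therefore
   sees exactly the environment that [Pi11] prescribes.  The odd half of the
   second-order variable serves as a table of powers of 2, its even half as
   the second-order variable of [phi]. *)
Definition last_bit_form (b : bool) (phi : aform) : aform :=
  let p := AVar 3 in
  let p2 := AAdd p p in
  let p3 := AAdd p2 p in
  let lo := if b then p3 else p2 in
  let table := AAnd (AMem (toddpair AZero AOne))
    (AAll 2 (AAll 3 (AOr (ANot (AMem (toddpair (AVar 2) p)))
      (AMem (toddpair (AAdd (AVar 2) AOne) p2))))) in
  AOr (ANot table)
    (AEx 2 (AEx 3 (AAnd (AMem (toddpair (AVar 2) p))
      (AAnd (AAnd (ANot (ALt (AVar 1) lo)) (ALt (AVar 1) (AAdd lo p)))
        (AEx 1 (AAnd (AEq (AVar 1) (AVar 2))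
          (AEx 2 (AAnd (AEq (AVar 2) AZero)
            (AEx 3 (AAnd (AEq (AVar 3) AZero) (adouble phi))))))))))).

(** The two leading binary digits of [strcode s] are the closing 1 and the last bit of [s]; they
    stand at positions [size s] and [size s - 1]. *)
Lemma strcode_last (b : bool) x s :
  (2 + b) * 2 ^ x <= strcode s < (3 + b) * 2 ^ x <->
  size s = x.+1 /\ nth (~~ b) s x = b.
Proof.
elim: s x => [|c s IH] x.
  rewrite /=; split=> [|[]//]; have : 0 < 2 ^ x by rewrite expn_gt0.
  by move: (2 ^ x) => p; nia.
case: x => [|x].
  have s0 := strcode_gt0 s.
  have s1 : strcode s = 1 <-> s = [::].
    split=> [|-> //]; case: s s0 {IH} => //= d s _.
    by have := strcode_gt0 s; lia.
  rewrite expn0 !muln1 /=; split=> [h|[[/size0nil ->] <-]] /=; last by case: c.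
  have /s1 -> : strcode s = 1 by move: h; clear; case: b c => [] [] /=; lia.
  by split=> //; move: h; clear; case: b c => [] [] /=; lia.
rewrite /= expnS; split=> [h|[[ss] nb]].
  suff /IH[-> ->] : (2 + b) * 2 ^ x <= strcode s < (3 + b) * 2 ^ x by [].
  by move: (2 ^ x) h; clear; case: b c => [] [] p /=; lia.
have /IH : size s = x.+1 /\ nth (~~ b) s x = b by [].
by move: (2 ^ x); clear; case: b c => [] [] p /=; lia.
Qed.

Definition last_bit_set (b : bool) (W : set (seq bool * nat)) :
    set (seq bool * seq bool) :=
  [set z | exists x, [/\ size z.2 = x.+1, nth (~~ b) z.2 x = b & W (z.1, x)]].

Lemma aholds_last_bit_form b phi X a c :
  aholds X (nth 0 [:: a; c]) (last_bit_form b phi) <->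
  (X (oddpair 0 1) /\
    (forall x p, X (oddpair x p) -> X (oddpair (x + 1) (p + p))) ->
  exists x p, [/\ X (oddpair x p), (2 + b) * p <= c < (3 + b) * p &
    aholds [set n | X (n + n)] (nth 0 [:: a; x]) phi]).
Proof.
have env x p : ([eta [eta [eta [eta [eta nth 0 [:: a; c] with 2 |-> x]
    with 3 |-> p] with 1 |-> x] with 2 |-> 0] with 3 |-> 0] : nat -> nat) =
    nth 0 [:: a; x].
  by apply/funext; do 4![case=> [//|]]; case.
have bnd p : (~ c < (if b then p + p + p else p + p) /\
    c < (if b then p + p + p else p + p) + p) <->
    (2 + b) * p <= c < (3 + b) * p.
  by case: b; split=> [[]|]; lia.
have lo x p : aeval [eta [eta nth 0 [:: a; c] with 2 |-> x] with 3 |-> p]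
    (if b then AAdd (AAdd (AVar 3) (AVar 3)) (AVar 3)
     else AAdd (AVar 3) (AVar 3)) = if b then p + p + p else p + p.
  by case: (b).
split.
  case=> [nT [T0 TS]|[x [p [Xxp [B [y [/= -> [z [/= -> [w [/= -> h]]]]]]]]]] T].
    exfalso; apply: nT; split=> // x p /=.
    by have [/TS|] := pselect (X (oddpair x p)); [right|left].
  exists x, p; split=> //; first by apply/bnd; rewrite -(lo x).
  by rewrite -(env x p); apply/aholds_adouble.
move=> h; have [T|] := pselect (X (oddpair 0 1) /\
  forall x p, X (oddpair x p) -> X (oddpair (x + 1) (p + p))); last first.
  move=> nT; left=> -[T0 TS]; apply: nT; split=> // x p Xxp.
  by case: (TS x p).
right; have [x [p [Xxp B hp]]] := h T.
exists x, p; split=> //; split; first by rewrite /= lo; apply/bnd.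
exists x; split=> //; exists 0; split=> //; exists 0; split=> //.
by apply/aholds_adouble; rewrite env.
Qed.

(** The closure conditions put every pair [(x, 2 ^ x)] into the table, which gives one direction.
    For the other, the formula only yields an [x] depending on the set variable; the quantifiers can
    be exchanged because [s] determines [x]. *)
Lemma Pi11_last_bit_set b W : Pi11 id W -> Pi11 strcode (last_bit_set b W).
Proof.
case=> phi Wphi; exists (last_bit_form b phi) => tau s; split.
  case=> x [/= sx nx /Wphi Wx] X; apply/aholds_last_bit_form => -[T0 TS].
  exists x, (2 ^ x); split; [|exact/strcode_last|exact: Wx].
  elim: x {sx nx Wx} => // x /TS.
  by rewrite addn1 addnn -mul2n -expnS.
move=> h.
have key (Y : set nat) : exists x, [/\ size s = x.+1, nth (~~ b) s x = b &
    aholds Y (nth 0 [:: strcode tau; x]) phi].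
  (* The even half is [Y], and the odd half is the least admissible table, the graph of [2 ^ x]. *)
  pose X : set nat := [set n | (exists2 m, n = m + m & Y m) \/
                               exists x, n = oddpair x (2 ^ x)].
  have Xodd x p : X (oddpair x p) <-> p = 2 ^ x.
    split=> [[[m /oddpair_odd//]|[y /oddpair_inj[-> //]]]|->].
    by right; exists x.
  have /aholds_last_bit_form[|x [p [/Xodd -> /strcode_last[sx nx] hx]]] := h X.
    split=> [|x p /Xodd ->]; apply/Xodd => //.
    by rewrite addn1 addnn -mul2n -expnS.
  exists x; split=> //; suff <- : [set n | X (n + n)] = Y by [].
  apply/seteqP; split=> n /=; last by left; exists n.
  case=> [[m /eqP]|[y /esym/oddpair_odd//]].
  by rewrite !addnn => /eqP/double_inj ->.
(* Any instance of [key] produces the same [x], the predecessor of [size s]. *)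
have [x [sx nx _]] := key set0.
exists x; split=> //; apply/Wphi => Y.
by have [y [sy _]] := key Y; move: sy; rewrite sx => -[->].
Qed.

(** * Effective closedness of the classes [constant_on b S] *)

Definition constant_on (b : bool) (S : set nat) : set (nat -> bool) :=
  [set Y | forall x, S x -> Y x = b].

Lemma constant_on_eff_closed A b S :
  higher_ce id A S -> higher_eff_closed A (constant_on b S).
Proof.
case=> W PiW ->.
exists (oracle_section (last_bit_set (~~ b) W) A).
  by exists (last_bit_set (~~ b) W) => //; exact: Pi11_last_bit_set.
apply/seteqP; split=> Y.
  move=> /existsNP[x /not_implyP[[tau tauA Wx] Yx]].
  exists (mkseq Y x.+1); first by rewrite /initseg size_mkseq.
  exists tau => //; exists x; rewrite size_mkseq nth_mkseq //; split=> //.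
  by move: Yx; case: (Y x) (b) => [] [].
case=> s sY [tau tauA [x [/= sx nx Wx]]] CY.
move: nx; rewrite sY nth_mkseq ?sx // CY; last by exists tau.
by case: (b).
Qed.

(** * Nullness of these classes for infinite [S] *)

Section null.
Context {R : realType}.
Local Notation mu := (@fair_coin R).

Lemma initseg_rcons s c Y :
  initseg s Y -> Y (size s) = c -> initseg (rcons s c) Y.
Proof. by move=> sY <-; rewrite /initseg size_rcons mkseqS -sY. Qed.

Lemma fair_coin_open_of_seq n (L : seq (seq bool)) :
  all (fun s => size s == n) L ->
  (mu (open_of [set` L]) <= ((size L)%:R * 2^-1 ^+ n)%:E)%E.
Proof.
elim: L => [_|s L IH /= /andP[/eqP sn /IH {}IH]].
  suff -> : open_of [set` [::]] = set0 by rewrite measure0 mul0r.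
  by apply/seteqP; split=> Y // -[].
have -> : open_of [set` s :: L] = cylinder s `|` open_of [set` L].
  apply/seteqP; split=> Y.
    by case=> t tY /=; rewrite inE => /orP[/eqP <-|tL]; [left|right; exists t].
  by case=> [sY|[t tY tL]]; [exists s => //=|exists t => //=];
    rewrite inE ?eqxx // tL orbT.
apply: le_trans (measureU2 (@fair_coin R) (measurable_cylinder s)
  (measurable_open_of [set` L])) _.
rewrite -nat1r mulrDl mul1r EFinD; apply: leeD => //.
by rewrite -sn -fair_coin_cylinder.
Qed.

(** Every position in [S] forces one bit and so halves the proportion of strings of a given length
    needed for a cover; infinitely many positions allow [k] halvings. *)
Lemma constant_on_cover b S k : infinite_set S ->
  exists n (L : seq (seq bool)), [/\ all (fun s => size s == n) L,
    size L * 2 ^ k = 2 ^ n & constant_on b S `<=` open_of [set` L]].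
Proof.
move=> Sinf; elim: k => [|k [n [L [Ln Lk CL]]]].
  by exists 0, [:: [::]]; split=> // Y _; exists [::] => /=.
(* Appending both bits doubles the list and [2 ^ n] alike, so strings can be lengthened at the same
   proportion until the next position in [S]. *)
have grow m : exists L : seq (seq bool), [/\ all (fun s => size s == m + n) L,
    size L * 2 ^ k = 2 ^ (m + n) & constant_on b S `<=` open_of [set` L]].
  elim: m => [|m [M [Mm Mk CM]]]; first by exists L.
  exists ([seq rcons s true | s <- M] ++ [seq rcons s false | s <- M]); split.
  - rewrite all_cat !all_map; apply/andP; split;
      by apply: sub_all Mm => s /eqP sm; rewrite /= size_rcons sm.
  - by rewrite size_cat !size_map mulnDl Mk addnn -mul2n -expnS.
  - move=> Y /CM[s sY sM]; exists (rcons s (Y (size s))).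
      exact: initseg_rcons.
    by rewrite /= mem_cat; case: (Y _);
      rewrite (map_f (fun s => rcons s _) sM) ?orbT.
have [x Sx nx] : exists2 x, S x & n <= x.
  apply: contrapT => h; apply: Sinf; apply: (sub_finite_set _ (finite_II n)).
  by move=> x Sx /=; rewrite ltnNge; apply/negP => nx; apply: h; exists x.
have [M] := grow (x - n); rewrite subnK // => -[Mx Mk CM].
(* At position [x] only the bit [b] is possible: the length grows by one and the list does not. *)
exists x.+1, [seq rcons s b | s <- M]; split.
- by rewrite all_map; apply: sub_all Mx => s /eqP sm; rewrite /= size_rcons sm.
- by rewrite size_map !expnS mulnCA Mk.
- move=> Y CY; have [s sY sM] := CM Y CY; exists (rcons s b).
    by apply: initseg_rcons => //; rewrite (eqP (allP Mx s sM)) CY.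
  exact: (map_f (fun s => rcons s b)).
Qed.

Lemma constant_on_null b S :
  measurable (constant_on b S : set cantorM) -> infinite_set S ->
  mu (constant_on b S) = 0%E.
Proof.
move=> mC Sinf.
have le k : (mu (constant_on b S) <= (2^-1 ^+ k)%:E)%E.
  have [n [L [Ln Lk CL]]] := constant_on_cover b k Sinf.
  apply: (@le_trans _ _ (mu (open_of [set` L]))).
    by apply: le_measure; rewrite ?inE //; exact: measurable_open_of.
  apply: le_trans (fair_coin_open_of_seq Ln) _; rewrite lee_fin.
  by rewrite !exprVn ler_pdivrMr ?exprn_gt0 // mulrC ler_pdivlMr ?exprn_gt0 //
    -!natrX -natrM Lk.
apply/eqP; rewrite eq_le measure_ge0 andbT.
apply: (cvge_ge (f := fun k => (2^-1 ^+ k)%:E) (F := \oo)).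
  exact: nearW.
apply: cvg_EFin; first exact: nearW.
apply: cvg_expr.
by rewrite ger0_norm ?invr_ge0 // invf_lt1 // ltr1n.
Qed.

End null.

(** * Final segments of [nat], and the two cases of the theorem *)

Lemma higher_ce_gt A N : higher_ce id A [set x | N < x].
Proof.
exists [set z | N < z.2]; last first.
  by apply/seteqP; split=> x /=; [exists [::]|case].
(* A closed numeral for [N], as [Pi11] allows no parameters. *)
pose num := iter N (AAdd AOne) AZero.
have numE e : aeval e num = N by rewrite /num; elim: (N) => //= n ->.
exists (ALt num (AVar 1)) => tau d /=.
by rewrite numE; split=> // /(_ set0).
Qed.

Theorem theorem5p4 (R : realType) (A : nat -> bool) (X : set nat) :
  higher_ce id A X -> ~ higher_kurtz_random R A (char_seq X).
Proof.
move=> ceX.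
suff [b [S [ceS Sinf XS]]] : exists b S, [/\ higher_ce id A S,
    infinite_set S & constant_on b S (char_seq X)].
  move=> /(_ _ (constant_on_eff_closed b ceS)); apply=> //.
  (* The class is Borel, being the complement of an open set. *)
  apply: constant_on_null => //; rewrite -[X in measurable X]setCK.
  have [V _ ->] := constant_on_eff_closed b ceS.
  by apply: measurableC; exact: measurable_open_of.
have [Xfin|Xinf] := pselect (finite_set X); last first.
  by exists true, X; split=> // x Xx; apply/asboolP.
have [N XN] : exists N, forall x, X x -> x <= N.
  have /finite_seqP[s ->] := Xfin.
  by exists (\max_(x <- s) x) => x xs; exact: leq_bigmax_seq.
exists false, [set x | N < x]; split; first exact: higher_ce_gt.
  move=> fin; apply: infinite_nat.
  rewrite -(setUv [set x | N < x]) finite_setU; split=> //.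
  by apply: sub_finite_set (finite_II N.+1) => x /= /negP; rewrite -leqNgt.
by move=> x /= Nx; apply/asboolP => /XN; rewrite leqNgt Nx.
Qed.
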